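(* Let $\lambda$ be a Young diagram, let $\mathcal H_\lambda=\{h(i,j):(i,j)\in\lambda\}$ be the multiset of hook numbers and $\mathcal H^\ast_\lambda=\{h^\ast(i,j):(i,j)\in\lambda\}$ the multiset of anti-hook numbers. Then $\mathcal H_\lambda$ majorizes $\mathcal H^\ast_\lambda$.
   Context: Let $\lambda=(\lambda_1\ge\dots\ge\lambda_\ell>0)$ be an integer partition with conjugate $\lambda'$; its Young diagram is the set of squares $(i,j)$ with $1\le i\le\ell$, $1\le j\le\lambda_i$. The hook length is $h(i,j)=\lambda_i-i+\lambda'_j-j+1$ and the anti-hook length is $h^\ast(i,j)=i+j-1$. Majorization: for two multisets $\mathcal A,\mathcal B$ of $n$ real numbers, let $a_1\ge\dots\ge a_n$ and $b_1\ge\dots\ge b_n$ be their elements in non-increasing order. $\mathcal A$ majorizes $\mathcal B$ if $a_1+\dots+a_k\ge b_1+\dots+b_k$ for all $1\le k<n$ and $a_1+\dots+a_n=b_1+\dots+b_n$. *)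

(* Defs.v *)
From mathcomp Require Import all_boot all_order all_algebra.

Set Implicit Arguments.
Unset Strict Implicit.
Unset Printing Implicit Defensive.

Import Order.TTheory GRing.Theory Num.Theory.

Local Open Scope ring_scope.

(* A finite multiset is represented by any sequence listing its elements with
   multiplicity; majorizes sorts its arguments, so the listing order is
   irrelevant. The entries of the sorted sequences are numbered from 0. *)
Definition majorizes (R : realDomainType) (A B : seq R) : Prop :=
  let a := sort >=%R A in
  let b := sort >=%R B in
  let n := size A in
  [/\ size B = n,
      forall k : nat, (1 <= k < n)%N ->
        \sum_(0 <= i < k) a`_i >= \sum_(0 <= i < k) b`_i
    & \sum_(0 <= i < n) a`_i = \sum_(0 <= i < n) b`_i].

Definition is_partition (la : seq nat) : bool := sorted geq la && (0%N \notin la).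

(* The i-th part, numbered from 1, and 0 past the last part. It is only meant
   to be used for i >= 1. *)
Definition part (la : seq nat) (i : nat) : nat := nth 0%N la i.-1.

(* The j-th part of the conjugate, 1 <= j <= la_1, is the height of the j-th
   column, that is, the number of parts of la that are >= j. *)
Definition conj_part (la : seq nat) : seq nat :=
  [seq count (leq j) la | j <- iota 1 (part la 1)].

Definition diagram (la : seq nat) : seq (nat * nat) :=
  [seq (i, j) | i <- iota 1 (size la), j <- iota 1 (part la i)].

(* Computed in int, so that no subtraction is truncated. *)
Definition hook (la : seq nat) (s : nat * nat) : int :=
  (part la s.1)%:Z - s.1%:Z + (part (conj_part la) s.2)%:Z - s.2%:Z + 1.

Definition antihook (s : nat * nat) : int := s.1%:Z + s.2%:Z - 1.

Definition hooks (la : seq nat) : seq int :=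
  [seq hook la s | s <- diagram la].

Definition antihooks (la : seq nat) : seq int :=
  [seq antihook s | s <- diagram la].

(* Main.v *)
Require Import Defs.
From mathcomp Require Import all_boot all_order all_algebra.
From mathcomp Require Import zify.

(* Majorization is equivalent to [\sum f(anti-hook) <= \sum f(hook)] for every
   convex [f]. That inequality is proved by induction on the number of rows.
   Deleting the first row (of length x) leaves a diagram mu whose hooks are
   unchanged and whose anti-hooks drop by one, so the induction hypothesis for
   [f(_ + 1)] reduces the claim to
     [\sum_(s in mu) (f(h s + 1) - f(h s))
        <= \sum_(1 <= j <= x) (f(h(1,j)) - f(x - j + 1))].
   It holds column by column: the i-th hook below h(1,j) is at most h(1,j) - i,
   the increments of [f] are nondecreasing, and
     [\sum_(1 <= i <= c) (f(h(1,j) - i + 1) - f(h(1,j) - i))]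
   telescopes to f(h(1,j)) - f(x - j + 1), where c is the leg length of the
   square (1,j). *)

Set Implicit Arguments.
Unset Strict Implicit.
Unset Printing Implicit Defensive.

Import Order.TTheory GRing.Theory Num.Theory.

Local Open Scope ring_scope.

Lemma sum_nth_sort (R : realDomainType) (s : seq R) (f : R -> R) :
  \sum_(0 <= i < size s) f (sort >=%R s)`_i = \sum_(x <- s) f x.
Proof.
rewrite -(size_sort >=%R s) -(big_nth 0 predT f).
by apply: perm_big; rewrite perm_sort.
Qed.

(* The threshold [t] to use is the k-th largest element of [A]. *)
Lemma prefix_sum_le (R : realDomainType) (A B : seq R) k :
    size B = size A -> (k < size A)%N ->
    (forall t, \sum_(x <- B) Num.max 0 (x - t) <= \sum_(x <- A) Num.max 0 (x - t)) ->
  \sum_(0 <= i < k) (sort >=%R B)`_i <= \sum_(0 <= i < k) (sort >=%R A)`_i.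
Proof.
move=> eqs ltk leBA; set a := sort _ A; set b := sort _ B.
have sa : size a = size A by rewrite size_sort.
have a_noninc i j : (i <= j < size A)%N -> a`_j <= a`_i.
  move=> /andP[leij ltj].
  apply: (@sorted_leq_nth _ >=%R) => //.
  - by move=> y x z /= xy yz; exact: le_trans yz xy.
  - by move=> x /=.
  - by apply: sort_sorted => x y /=; rewrite orbC le_total.
  - by rewrite inE sa (leq_ltn_trans leij).
  - by rewrite inE sa.
set t := a`_k.
have {leBA} := leBA t.
rewrite -(sum_nth_sort B) -(sum_nth_sort A) -/a -/b eqs.
rewrite !(big_cat_nat (leq0n k) (ltnW ltk)) /=.
(* With indices from 0, entries of [a] from [k] on are at most [t], so their terms vanish; the
   earlier ones are at least [t], so there the maximum is [a_i - t]. *)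
rewrite [X in _ <= _ + X]big_nat_cond [X in _ <= _ + X]big1; last first.
  move=> i; rewrite andbT => /a_noninc le_it.
  by apply/max_idPl; rewrite subr_le0.
rewrite addr0 [X in _ <= X](_ : _ = \sum_(0 <= i < k) (a`_i - t)); last first.
  apply: eq_big_nat => i /andP[_ ltik].
  by apply/max_idPr; rewrite subr_ge0 a_noninc // (ltnW ltik).
move=> leBA; rewrite -(lerD2r (\sum_(0 <= i < k) - t)) -!big_split /=.
(* On the side of [b], each term is at least [b_i - t] for [i < k] and at least 0 beyond. *)
apply: le_trans leBA; rewrite -[X in X <= _]addr0; apply: lerD.
  by apply: ler_sum => i _; rewrite le_max lexx orbT.
by apply: sumr_ge0 => i _; rewrite le_max lexx.
Qed.

Lemma majorizes_of_sums (R : realDomainType) (A B : seq R) :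
    size B = size A -> \sum_(x <- A) x = \sum_(x <- B) x ->
    (forall t, \sum_(x <- B) Num.max 0 (x - t) <= \sum_(x <- A) Num.max 0 (x - t)) ->
  majorizes A B.
Proof.
move=> eqs eqAB leBA; split=> // [k /andP[_ ltk]|].
  exact: prefix_sum_le.
by rewrite -{2}eqs (sum_nth_sort A id) (sum_nth_sort B id).
Qed.

(** Parts larger than [j] form a prefix of a non-increasing sequence. Both sides say that the square
    with coordinates [(i, j)], counted from 0, lies in the diagram; the default 0 covers rows past
    the end. *)
Lemma ltn_nth_count (la : seq nat) i j :
  sorted geq la -> (j < nth 0 la i)%N = (i < count (ltn j) la)%N.
Proof.
elim: la i => [|x la IH] i /=; first by rewrite nth_nil.
rewrite path_sortedE => [/andP[lex sla]|]; last by move=> a b c /= *; lia.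
have [ltjx|lexj] := ltnP j x; first by case: i => [|i] /=; rewrite ?IH.
rewrite (_ : count _ la = 0%N).
  case: i => [|i] /=; first by rewrite ltnNge lexj.
  rewrite ltn0 ltnNge; apply/negbF.
  have [lti|/(nth_default 0%N)->//] := ltnP i (size la).
  by apply: leq_trans lexj; apply: (allP lex); rewrite mem_nth.
apply/eqP; rewrite -leqn0 leqNgt -has_count -all_predC.
by apply: sub_all lex => y /= leyx; rewrite -leqNgt (leq_trans leyx).
Qed.

Lemma big_diagram (R : nmodType) (F : nat * nat -> R) (la : seq nat) :
  \sum_(s <- diagram la) F s
    = \sum_(i < size la) \sum_(j < nth 0%N la i) F (i.+1, j.+1).
Proof.
rewrite /diagram big_allpairs_dep -(addn0 1%N) iotaDl big_map /= -{1}(subn0 (size la)).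
rewrite -/(index_iota _ _) big_mkord; apply: eq_bigr => i _.
rewrite /part /= iotaDl big_map -{1}(subn0 (nth _ _ _)).
by rewrite -/(index_iota _ _) big_mkord.
Qed.

Lemma sum_antihooks (f : int -> int) la :
  \sum_(x <- antihooks la) f x
    = \sum_(i < size la) \sum_(j < nth 0%N la i) f ((i + j)%:Z + 1).
Proof.
rewrite /antihooks big_map big_diagram.
apply: eq_bigr => i _; apply: eq_bigr => j _; congr f; rewrite /antihook /=; lia.
Qed.

Lemma part_conj_part la j :
  (j < part la 1)%N -> part (conj_part la) j.+1 = count (ltn j) la.
Proof.
by move=> ltj; rewrite /conj_part {1}/part (nth_map 0%N) ?size_iota // nth_iota.
Qed.

Lemma nth_le_head (x : nat) (la : seq nat) i :
  sorted geq (x :: la) -> (nth 0 la i <= x)%N.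
Proof.
move=> sla; rewrite leqNgt -[nth 0%N la i]/(nth 0%N (x :: la) i.+1).
apply/negP; rewrite ltn_nth_count // => /(leq_ltn_trans (leq0n i.+1)).
move=> lt0; have := ltn_nth_count 0 x sla.
rewrite lt0 /= ltnn; lia.
Qed.

Lemma sum_hooks (f : int -> int) la :
    sorted geq la ->
  \sum_(x <- hooks la) f x
    = \sum_(i < size la) \sum_(j < nth 0%N la i)
        f ((nth 0%N la i)%:Z - i%:Z + (count (ltn j) la)%:Z - j%:Z - 1).
Proof.
move=> sla; rewrite /hooks big_map big_diagram.
apply: eq_bigr => i _; apply: eq_bigr => j _; congr f.
rewrite /hook [part la _]/part /= part_conj_part; first by lia.
(* The conjugate only lists columns up to the first part, so [j] must be bounded by it. *)
apply: leq_trans (ltn_ord j) _; rewrite /part /=.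
case: la sla i j => [|x la] sla [i lti] j /=; first by rewrite nth_nil.
by case: i lti j => //= i _ _; apply: nth_le_head.
Qed.

(** Columns range over the length [x] of the removed first row, some possibly empty in [la], so that
    they match the squares of that row one by one. *)
Lemma sum_diagram_by_columns (R : nmodType) (x : nat) la (g : nat -> nat -> R) :
    sorted geq (x :: la) ->
  \sum_(i < size la) \sum_(j < nth 0%N la i) g i j
    = \sum_(j < x) \sum_(i < count (ltn j) la) g i j.
Proof.
move=> sxla; have sla := path_sorted sxla.
under eq_bigr => i _ do
  rewrite (big_ord_widen x (fun j => g i j)) ?(nth_le_head i) //.
rewrite [LHS](exchange_big_dep predT) //=; apply: eq_bigr => j _.
rewrite (big_ord_widen (size la) (fun i => g i j)) ?count_size //.
by apply: eq_bigl => i; rewrite ltn_nth_count.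
Qed.

Definition convex_int (f : int -> int) :=
  forall u v, u <= v -> f (u + 1) - f u <= f (v + 1) - f v.

(** The right side telescopes into the increments at [y + c - 1, ..., y]; by convexity the one at
    [y + c - 1 - i] dominates that at [h i]. *)
Lemma sum_increments_le (f : int -> int) (y : int) (c : nat) (h : nat -> int) :
    convex_int f -> (forall i, (i < c)%N -> h i <= y + c%:Z - i%:Z - 1) ->
  \sum_(i < c) (f (h i + 1) - f (h i)) <= f (y + c%:Z) - f y.
Proof.
move=> cf; elim: c h => [|c IH] h leh; first by rewrite big_ord0 addr0 subrr.
rewrite big_ord_recl /=.
have le0 : h 0%N <= y + c%:Z by have := leh 0%N isT; lia.
have leS : \sum_(i < c) (f (h i.+1 + 1) - f (h i.+1)) <= f (y + c%:Z) - f y.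
  by apply: (IH (h \o succn)) => i ltic /=; have := leh i.+1 ltic; lia.
have := lerD (cf _ _ le0) leS.
rewrite (_ : y + c.+1%:Z = y + c%:Z + 1); last by lia.
by rewrite addrA subrK.
Qed.

Lemma sum_antihooks_le (f : int -> int) la :
    sorted geq la -> convex_int f ->
  \sum_(x <- antihooks la) f x <= \sum_(x <- hooks la) f x.
Proof.
move=> sla; rewrite sum_antihooks sum_hooks //.
elim: la f sla => [|x la IH] f sxla cf; first by rewrite !big_ord0.
have sla := path_sorted sxla.
pose hk i (j : nat) : int :=
  (nth 0%N la i)%:Z - i%:Z + (count (ltn j) la)%:Z - j%:Z - 1.
have cf1 : convex_int (fun u => f (u + 1)) by move=> u v leuv; apply: cf; lia.
have {IH} := IH (fun u => f (u + 1)) sla cf1.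
rewrite ![size _]/= !big_ord_recl /= => leIH.
(* The first row has anti-hooks 1 to [x]; reversing it pairs [x - j] with the hook in column [j],
   which exceeds it by the leg length. *)
have row1 : \sum_(j < x) f ((0 + j)%:Z + 1) = \sum_(j < x) f (x%:Z - j%:Z).
  rewrite [RHS](reindex_inj rev_ord_inj); apply: eq_bigr => j _; congr f => /=.
  by have := ltn_ord j; lia.
have hook1 : \sum_(j < x) f (x%:Z - 0%:Z + ((j < x) + count (ltn j) la)%N%:Z - j%:Z - 1)
    = \sum_(j < x) f (x%:Z - j%:Z + (count (ltn j) la)%:Z).
  by apply: eq_bigr => j _; rewrite ltn_ord; congr f; lia.
(* The extra square that the first row adds to each column cancels the shift of the row index. *)
have hookS : \sum_(i < size la) \sum_(j < nth 0%N la i)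
      f ((nth 0%N la i)%:Z - (bump 0 i)%:Z + ((j < x) + count (ltn j) la)%N%:Z - j%:Z - 1)
    = \sum_(i < size la) \sum_(j < nth 0%N la i) f (hk i j).
  apply: eq_bigr => i _; apply: eq_bigr => j _.
  rewrite (leq_trans (ltn_ord j) (nth_le_head i sxla)) /hk /bump; congr f; lia.
have antiS : \sum_(i < size la) \sum_(j < nth 0%N la i) f ((bump 0 i + j)%:Z + 1)
    = \sum_(i < size la) \sum_(j < nth 0%N la i) f ((i + j)%:Z + 1 + 1).
  by apply: eq_bigr => i _; apply: eq_bigr => j _; congr f; rewrite /bump; lia.
rewrite row1 hook1 hookS antiS.
apply: le_trans (lerD (lexx _) leIH) _.
rewrite !(sum_diagram_by_columns (fun i j => f (hk i j + 1)) sxla).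
rewrite (sum_diagram_by_columns (fun i j => f (hk i j)) sxla) -!big_split /=.
apply: ler_sum => j _.
(* Lower rows have length at most [x]; this is the bound of [sum_increments_le] with [y = x - j]. *)
have leh i : (i < count (ltn j) la)%N ->
    hk i j <= x%:Z - j%:Z + (count (ltn j) la)%:Z - i%:Z - 1.
  by move=> _; have := nth_le_head i sxla; rewrite /hk; lia.
have := sum_increments_le cf leh.
by rewrite sumrB lerBlDr addrAC lerBrDr [X in X <= _ -> _]addrC.
Qed.

Lemma convex_max0 (t : int) : convex_int (fun u => Num.max 0 (u - t)).
Proof. by move=> u v leuv; lia. Qed.

Theorem theorem3p3 (la : seq nat) (hla : is_partition la) :
  majorizes (hooks la) (antihooks la).
Proof.
have /andP[sla _] := hla.
apply: majorizes_of_sums => [||t].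
- by rewrite /hooks /antihooks !size_map.
(* Both the identity and its negative are convex, which gives the two inequalities between the
   totals. *)
- apply/eqP; rewrite eq_le; apply/andP; split.
    rewrite -lerN2 -!sumrN.
    by apply: (sum_antihooks_le (f := -%R)) => // u v _; lia.
  by apply: (sum_antihooks_le (f := id)) => // u v _; lia.
- exact: sum_antihooks_le (@convex_max0 t).
Qed.
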